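(* Let $\mathcal{A}$ be a factor von Neumann algebra, and let $\Phi:\mathcal{A}\to\mathcal{A}$ be a surjective map (not assumed additive or linear). Then $\Phi$ is strong skew commutativity preserving, that is, $\Phi(A)\Phi(B)-\Phi(B)\Phi(A)^*=AB-BA^*$ for all $A,B\in\mathcal{A}$, if and only if there is $\alpha\in\{1,-1\}$ such that $\Phi(A)=\alpha A$ for all $A\in\mathcal{A}$.
   Context: A von Neumann algebra is a $*$-subalgebra $\mathcal{M}$ of $\mathcal{B}(H)$, the bounded linear operators on a complex Hilbert space $H$, that equals its double commutant: $\mathcal{M}''=\mathcal{M}$. It is a factor if its center is $\mathbb{C}I$. *)

(* Defs.v *)
From HB Require Import structures.
From mathcomp Require Import all_boot all_order all_algebra.
From mathcomp Require Import complex ring lra.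
From mathcomp Require Import boolp classical_sets functions reals topology
  normedtype.

Set Implicit Arguments.
Unset Strict Implicit.
Unset Printing Implicit Defensive.

Import Order.TTheory GRing.Theory Num.Theory.
Import numFieldNormedType.Exports.

Local Open Scope classical_set_scope.
Local Open Scope ring_scope.

(* The inner product is linear in its first argument and conjugate-linear in
   the second. *)
HB.mixin Record NormedModule_isHilbert (R : realType) H
    of CompleteNormedModule R[i] H := {
  inner : {dot H for (@Num.conj R[i])} ;
  norm_sqr_inner : forall x : H, `|x| ^+ 2 = inner x x
}.

#[short(type="hilbertType")]
HB.structure Definition Hilbert (R : realType) :=
  {H of CompleteNormedModule R[i] H & NormedModule_isHilbert R H}.

Section HilbertTheory.
Context {R : realType} {H : hilbertType R}.
Implicit Types (x y z : H) (c : R[i]).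

Lemma innerDl x y z : inner (x + y) z = inner x z + inner y z.
Proof. exact: linearDl. Qed.
Lemma innerBl x y z : inner (x - y) z = inner x z - inner y z.
Proof. exact: linearBl. Qed.
Lemma innerZl c x y : inner (c *: x) y = c * inner x y.
Proof. exact: linearZl_LR. Qed.
Lemma inner0r x : inner x 0 = 0.
Proof. exact: linear0r. Qed.
Lemma innerDr x y z : inner z (x + y) = inner z x + inner z y.
Proof. exact: linearDr. Qed.
Lemma innerBr x y z : inner z (x - y) = inner z x - inner z y.
Proof. exact: linearBr. Qed.
Lemma innerZr c x y : inner x (c *: y) = c^* * inner x y.
Proof. exact: linearZr_LR. Qed.
Lemma innerC x y : inner y x = (inner x y)^*.
Proof. by rewrite (@hermC _ false Num.conj _ inner) expr0 mul1r. Qed.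

Lemma eq_innerr y z : (forall x, inner x y = inner x z) -> y = z.
Proof.
move=> yz; apply/eqP; rewrite -subr_eq0 -normr_eq0 -sqrf_eq0.
by rewrite norm_sqr_inner innerBr yz subrr.
Qed.

Lemma parallelogram x y :
  `|x - y| ^+ 2 + `|x + y| ^+ 2 = 2 * `|x| ^+ 2 + 2 * `|y| ^+ 2.
Proof. by rewrite !norm_sqr_inner !(innerBl, innerBr, innerDl, innerDr); ring. Qed.

Lemma norm_sqr_proj x y : y != 0 ->
  `|x - (inner x y / `|y| ^+ 2) *: y| ^+ 2 =
  `|x| ^+ 2 - `|inner x y| ^+ 2 / `|y| ^+ 2.
Proof.
move=> y0; have n0 : `|y| ^+ 2 != 0 by rewrite sqrf_eq0 normr_eq0.
have nC : (`|y| ^+ 2)^* = `|y| ^+ 2.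
  by apply: conj_Creal; rewrite rpredX ?normr_real.
rewrite norm_sqr_inner !(innerBl, innerBr, innerZl, innerZr).
rewrite rmorphM fmorphV /= nC -!norm_sqr_inner normCK (innerC x y).
by field; rewrite normr_eq0.
Qed.

Lemma inner_norm_le x y : `|inner x y| <= `|x| * `|y|.
Proof.
have [->|y0] := eqVneq y 0.
  by rewrite inner0r !normr0 mulr0.
rewrite -(@ler_pXn2r _ 2) ?nnegrE ?mulr_ge0 ?normr_ge0// exprMn.
rewrite -ler_pdivrMr ?exprn_gt0 ?normr_gt0// -subr_ge0.
by rewrite -norm_sqr_proj ?exprn_ge0.
Qed.

Let nr x : R := complex.Re `|x|.

Let nrE x : `|x| = (nr x)%:C%C.
Proof. by rewrite RRe_real ?normr_real. Qed.

Let nr_ge0 x : 0 <= nr x.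
Proof. by rewrite -lecR -nrE normr_ge0. Qed.

Let nr_tri x y : nr (x + y) <= nr x + nr y.
Proof. by rewrite -lecR rmorphD /= -!nrE ler_normD. Qed.

Let nrZ (a : R) x : 0 <= a -> nr (a%:C%C *: x) = a * nr x.
Proof.
move=> a0; apply: complexI.
by rewrite rmorphM /= -!nrE normrZ ger0_norm ?lecR.
Qed.

Let nr_parallelogram x y :
  nr (x - y) ^+ 2 + nr (x + y) ^+ 2 = 2 * nr x ^+ 2 + 2 * nr y ^+ 2.
Proof.
have n2 : (2 : R[i]) = (2 : R)%:C%C by rewrite rmorph_nat.
have := parallelogram x y; rewrite !nrE n2 -!rmorphXn -!rmorphM -!rmorphD.
exact: complexI.
Qed.

Section Riesz.
Context (f : H -> R[i]) (k : R[i]).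
Hypothesis fD : {morph f : x y / x + y}.
Hypothesis fZ : forall c, {morph f : x / c *: x >-> c * x}.
Hypothesis fk : forall x, `|f x| <= k * `|x|.

Let fB x y : f (x - y) = f x - f y.
Proof. by rewrite fD -scaleN1r fZ mulN1r. Qed.

Let min_norm u : f u = 1 ->
  exists2 z, f z = 1 & forall x, f x = 1 -> `|z| <= `|x|.
Proof.
move=> fu.
have kR : k = (complex.Re k)%:C%C.
  rewrite RRe_real// ger0_real//.
  have u0 : 0 < `|u|.
    rewrite normr_gt0; apply/eqP => u0; move: fu; rewrite u0 -(scale0r 0) fZ.
    by rewrite mul0r => /esym/eqP; rewrite oner_eq0.
  by rewrite -(pmulr_lge0 _ u0) (le_trans _ (fk u)).
set k' := complex.Re k in kR.
pose S := [set nr x | x in [set x | f x = 1]].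
have Slb : has_lbound S by exists 0 => _ [x _ <-].
have Sinf : has_inf S by split => //; exists (nr u), u.
pose D := inf S.
have D_le x : f x = 1 -> D <= nr x by move=> fx; apply: ge_inf => //; exists x.
have D_ge0 : 0 <= D by apply: lb_le_inf; [case: Sinf | move=> _ [x _ <-]].
pose K (e : R) := [set x | f x = 1 /\ nr x < D + e].
pose F := filter_from [set e : R | 0 < e] K.
have FF : ProperFilter F.
  apply: filter_from_proper.
    apply: filter_from_filter; first by exists 1; rewrite /= ltr01.
    move=> e1 e2 /= e10 e20; exists (Num.min e1 e2).
      by rewrite /= lt_min e10.
    move=> x [fx xe]; split; split => //; apply: lt_le_trans xe _.
      by rewrite lerD2l ge_min lexx.
    by rewrite lerD2l ge_min lexx orbT.
  move=> e e0; have [_ [x fx <-] xe] := inf_adherent e0 Sinf.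
  by exists x.
have KB e x y : 0 < e -> K e x -> K e y -> nr (x - y) ^+ 2 < 4 * e * (2 * D + e).
  move=> e0 [fx xe] [fy ye].
  have : D <= nr ((2^-1)%:C%C *: (x + y)).
    apply: D_le; rewrite fZ fD fx fy fmorphV rmorphD rmorph1 mulVf//.
    by rewrite -[1 + 1]/(2%:R) pnatr_eq0.
  rewrite nrZ ?invr_ge0// => Dxy.
  have := nr_parallelogram x y.
  have := nr_ge0 x; have := nr_ge0 y; nra.
have : cvg F.
  apply/cauchy_cvgP; apply: cauchy_exP => eps eps0.
  have epsE : eps = (complex.Re eps)%:C%C by rewrite RRe_real ?gtr0_real.
  set r := complex.Re eps in epsE.
  have r0 : 0 < r by rewrite -ltcR -epsE.
  have d0 : 0 < 8 * (2 * D + 1) by lra.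
  pose e := Num.min 1 (r ^+ 2 / (8 * (2 * D + 1))).
  have e0 : 0 < e by rewrite lt_min ltr01 divr_gt0 ?exprn_gt0.
  have e1 : e <= 1 by rewrite ge_min lexx.
  have er : e * (8 * (2 * D + 1)) <= r ^+ 2.
    by rewrite -ler_pdivlMr// ge_min lexx orbT.
  have [x Kx] : K e !=set0.
    by have [_ [x fx <-] xe] := inf_adherent e0 Sinf; exists x.
  exists x, e => //= y Ky; rewrite -ball_normE /= epsE nrE ltcR.
  have := KB _ _ _ e0 Kx Ky.
  have := nr_ge0 (x - y); nra.
move=> /cvg_ex[z Fz].
have zP (e : R) : 0 < e -> exists2 x, K e x & nr (z - x) < e.
  move=> e0.
  have eC0 : 0 < e%:C%C :> R[i] by rewrite ltcR.
  have Fe : F (K e) by exists e.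
  have Fz' : F [set x | `|z - x| < e%:C%C].
    by apply: Fz; apply/nbhs_normP; exists e%:C%C.
  have /filter_ex[x [Kx zx]] := @filterI _ _ FF _ _ Fe Fz'.
  by exists x => //; rewrite -ltcR -nrE.
exists z.
  apply/eqP; rewrite -subr_eq0 -normr_eq0; apply/negPn/negP => fz0.
  have a0 : 0 < complex.Re `|f z - 1|.
    by rewrite -ltcR RRe_real ?normr_real// lt0r fz0 normr_ge0.
  set a := complex.Re _ in a0.
  have aE e : 0 < e -> a <= k' * e.
    move=> e0; have [x [fx _] zx] := zP _ e0.
    have k'0 : 0 <= k'.
      have := fk u; rewrite fu normr1 kR nrE -rmorphM -(rmorph1 (real_complex R)) lecR.
      have := nr_ge0 u; nra.
    apply: (@le_trans _ _ (k' * nr (z - x))); last by rewrite ler_wpM2l// ltW.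
    rewrite -lecR rmorphM /= -nrE -kR RRe_real ?normr_real//.
    by rewrite -{1}fx -fB.
  have k'0 : 0 <= k' by have := aE 1 ltr01; lra.
  have e0 : 0 < a / (k' + 1) by rewrite divr_gt0//; lra.
  have := aE _ e0; rewrite mulrA ler_pdivlMr; last lra.
  by nra.
move=> x fx; rewrite !nrE lecR; apply: le_trans (D_le _ fx).
apply/ler_addgt0Pr => e e0.
have e20 : 0 < e / 2 by rewrite divr_gt0.
have [y [fy ye] zy] := zP _ e20.
have := nr_tri (z - y) y; rewrite subrK; lra.
Qed.

Lemma riesz_representation : exists z, forall x, f x = inner x z.
Proof.
have [f0|/existsNP[x0 fx0]] := pselect (forall x, f x = 0).
  by exists 0 => x; rewrite f0 inner0r.
have [|z fz zmin] := @min_norm ((f x0)^-1 *: x0).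
  by rewrite fZ mulVf//; exact/eqP.
have orth w : f w = 0 -> inner z w = 0.
  move=> fw; have [->|w0] := eqVneq w 0.
    by rewrite inner0r.
  have /zmin : f (z - (inner z w / `|w| ^+ 2) *: w) = 1.
    by rewrite fB fZ fw mulr0 subr0.
  rewrite -(@ler_pXn2r _ 2) ?nnegrE// norm_sqr_proj// lerBrDr gerDl.
  rewrite pmulr_lle0 ?invr_gt0 ?exprn_gt0 ?normr_gt0// => zw.
  apply/eqP; rewrite -normr_eq0 -sqrf_eq0.
  by rewrite eq_le zw exprn_ge0.
have z0 : z != 0.
  apply/eqP => z0; move: fz; rewrite z0 -(scale0r 0) fZ mul0r => /esym/eqP.
  by rewrite oner_eq0.
have n0 : `|z| ^+ 2 != 0 by rewrite sqrf_eq0 normr_eq0.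
exists ((`|z| ^+ 2)^-1 *: z) => x.
have nC : (`|z| ^+ 2)^* = `|z| ^+ 2.
  by apply: conj_Creal; rewrite rpredX ?normr_real.
have /orth : f (x - f x *: z) = 0 by rewrite fB fZ fz mulr1 subrr.
rewrite innerC => /eqP; rewrite conjC_eq0 innerBl innerZl subr_eq0 => /eqP xz.
by rewrite innerZr fmorphV /= nC xz -norm_sqr_inner mulrC mulfK.
Qed.
End Riesz.
End HilbertTheory.

Section BoundedOperators.
Context {R : realType} (H : hilbertType R).

(* In [R[i]], [u <= v] forces [v - u] to be real, so [k] is a real bound
   whenever [H] is not zero. *)
Definition bounded_operator : {pred H -> H} :=
  fun f => `[< linear f /\ exists k : R[i], forall x, `|f x| <= k * `|x| >].

Record boundedOp := BoundedOp {
  boundedOp_fun :> H -> H ;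
  _ : boundedOp_fun \in bounded_operator
}.

HB.instance Definition _ := [isSub for boundedOp_fun].
HB.instance Definition _ := [Choice of boundedOp by <:].
Implicit Types A B : boundedOp.

Lemma boundedOpP A : linear A /\ exists k : R[i], forall x, `|A x| <= k * `|x|.
Proof. by have /asboolP := valP A. Qed.

Lemma boundedOpD A x y : A (x + y) = A x + A y.
Proof. by have [Al _] := boundedOpP A; rewrite -[x]scale1r Al !scale1r. Qed.

Lemma boundedOp0 A : A 0 = 0.
Proof. by apply: (addrI (A 0)); rewrite -boundedOpD !addr0. Qed.

Lemma boundedOpZ A c x : A (c *: x) = c *: A x.
Proof.
have [Al _] := boundedOpP A.
by rewrite -[c *: x]addr0 Al boundedOp0 addr0.
Qed.

Lemma boundedOp_eqP A B : A =1 B -> A = B.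
Proof. by move=> AB; apply/val_inj/funext. Qed.

Lemma bounded_operator_submod_closed : subsemimod_closed bounded_operator.
Proof.
have E0 x : (0 : H -> H) x = 0 by [].
have ED (f g : H -> H) x : (f + g) x = f x + g x by [].
have EZ c (f : H -> H) x : (c *: f) x = c *: f x by [].
split; first split.
- apply/asboolP; split=> [c x y|]; first by rewrite !E0 scaler0 addr0.
  by exists 0 => x; rewrite E0 normr0 mul0r.
- move=> f g /asboolP[fl [k fk]] /asboolP[gl [l gl']]; apply/asboolP; split.
    by move=> c x y; rewrite !ED fl gl scalerDr addrACA.
  exists (k + l) => x; rewrite ED mulrDl (le_trans (ler_normD _ _))//.
  exact: lerD.
- move=> c f /asboolP[fl [k fk]]; apply/asboolP; split.
    move=> a x y; rewrite !EZ fl scalerDr !scalerA.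
    by rewrite [c * a]mulrC.
  by exists (`|c| * k) => x; rewrite EZ normrZ -mulrA ler_wpM2l.
Qed.

HB.instance Definition _ :=
  GRing.SubChoice_isSubLmodule.Build R[i] (H -> H) bounded_operator boundedOp
    bounded_operator_submod_closed.

Fact id_bounded : idfun \in bounded_operator.
Proof. by apply/asboolP; split=> //; exists 1 => x; rewrite mul1r. Qed.

Fact comp_bounded A B : A \o B \in bounded_operator.
Proof.
have [Al [k Ak]] := boundedOpP A; have [Bl [l Bl']] := boundedOpP B.
apply/asboolP; split; first by move=> c x y; rewrite /= Bl Al.
have [k0|k0] := boolP (0 <= k).
  exists (k * l) => x /=.
  by rewrite (le_trans (Ak _))// -mulrA ler_wpM2l.
exists 0 => x; rewrite mul0r /=.
have [->|B0] := eqVneq (B x) 0; first by rewrite boundedOp0 normr0.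
move: k0; rewrite -(@pmulr_lge0 _ `|B x|) ?normr_gt0//.
by rewrite (le_trans _ (Ak _)).
Qed.

Definition oneOp := BoundedOp id_bounded.
Definition compOp A B := BoundedOp (comp_bounded A B).

Fact compOpA : associative compOp.
Proof. by move=> A B C; exact: boundedOp_eqP. Qed.
Fact comp1Op : left_id oneOp compOp.
Proof. by move=> A; exact: boundedOp_eqP. Qed.
Fact compOp1 : right_id oneOp compOp.
Proof. by move=> A; exact: boundedOp_eqP. Qed.
Fact compOpDl : left_distributive compOp +%R.
Proof. by move=> A B C; exact: boundedOp_eqP. Qed.
Fact compOpDr : right_distributive compOp +%R.
Proof.
move=> A B C; apply: boundedOp_eqP => x; exact: boundedOpD.
Qed.

(* Possibly-zero rings, because [H] may be the zero space, in which case
   [1 = 0] in [boundedOp H]. *)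
HB.instance Definition _ := GRing.Zmodule_isPzRing.Build boundedOp
  compOpA comp1Op compOp1 compOpDl compOpDr.

Lemma scaleOpAl c A B : c *: (A * B) = (c *: A) * B.
Proof. exact: boundedOp_eqP. Qed.
Lemma scaleOpAr c A B : c *: (A * B) = A * (c *: B).
Proof.
by apply: boundedOp_eqP => x; exact/esym/boundedOpZ.
Qed.

Lemma exists_adjoint A :
  exists B, forall x y, inner (A x) y = inner x (B y).
Proof.
have [_ [k Ak]] := boundedOpP A.
have /choice[g gP] (y : H) : exists z, forall x, inner (A x) y = inner x z.
  apply: (@riesz_representation _ _ _ (k * `|y|)).
  - by move=> u v; rewrite boundedOpD innerDl.
  - by move=> c u; rewrite boundedOpZ innerZl.
  - move=> x; rewrite (le_trans (inner_norm_le _ _))// mulrAC.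
    by rewrite ler_wpM2r.
have gB : g \in bounded_operator.
  apply/asboolP; split.
    move=> c x y; apply: eq_innerr => z.
    by rewrite -gP !(innerDr, innerZr) !gP.
  exists k => x; have [gx0|gx0] := eqVneq (g x) 0.
    by rewrite gx0 normr0 (le_trans _ (Ak x)).
  rewrite -(@ler_pM2r _ `|g x|) ?normr_gt0//.
  rewrite -expr2 norm_sqr_inner -gP -[inner _ _]ger0_norm.
    by rewrite (le_trans (inner_norm_le _ _))// mulrAC ler_wpM2r.
  by rewrite gP -norm_sqr_inner exprn_ge0.
by exists (BoundedOp gB) => x y; rewrite gP.
Qed.

(* [B] is unique by [eq_innerr], so the choice is immaterial. *)
Definition adjoint A : boundedOp := sval (cid (exists_adjoint A)).

Lemma adjointP A x y : inner (A x) y = inner x (adjoint A y).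
Proof. by rewrite /adjoint; case: cid. Qed.

End BoundedOperators.

Section VonNeumannAlgebras.
Context {R : realType} {H : hilbertType R}.
Implicit Types M : set (boundedOp H).

Definition star_subalgebra M :=
  [/\ M 0,
      forall (c : R[i]) A B, M A -> M B -> M (c *: A + B),
      forall A B, M A -> M B -> M (A * B) &
      forall A, M A -> M (adjoint A)].

Definition commutant M : set (boundedOp H) :=
  [set B | forall A, M A -> A * B = B * A].

Definition von_neumann_algebra M :=
  star_subalgebra M /\ commutant (commutant M) = M.

Definition center M : set (boundedOp H) := M `&` commutant M.

Definition von_neumann_factor M :=
  von_neumann_algebra M /\ center M =
    [set c *: (1 : boundedOp H) | c in [set: R[i]]].

End VonNeumannAlgebras.

(* Main.v *)
Require Import Defs.
From mathcomp Require Import all_boot all_order all_algebra.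
From mathcomp Require Import complex.
From mathcomp Require Import boolp classical_sets functions reals topology
  normedtype.
Import Order.TTheory GRing.Theory Num.Theory.
Local Open Scope ring_scope.

(** Write [A, B]_* = A B - B A^* and let Phi preserve this product. As i is
    skew-adjoint, [i 1, X]_* = 2 i X, so an element of M annihilated by all
    [A, _]_* with A in M vanishes. By surjectivity the Phi A exhaust M, and as
    [A, i B]_* = i [A, B]_* this forces Phi (i B) = i Phi B
    ([skew_preserving_imaginary]).

    Put T = Phi 1. Comparing the preservation identities for (1, B) and
    (i 1, B) gives T Phi(B) - Phi(B) T^* = 0 and T Phi(B) + Phi(B) T^* = 2 B,
    that is T Phi(B) = B = Phi(B) T^*. The case B = 1 reads T T = 1 = T T^*,
    so T is its own inverse and equals T^*; hence Phi(B) = T B = B T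
    ([skew_preserving_mul_unit]). Thus T is a central square root of 1, and
    in a factor it is 1 or -1. *)

Section Operators.
Context {R : realType} {H : hilbertType R}.
Implicit Types (A B X : boundedOp H) (c : R[i]).

Lemma adjointZ c A : adjoint (c *: A) = c^* *: adjoint A.
Proof.
apply: boundedOp_eqP => y; apply: eq_innerr => x.
rewrite -adjointP.
have -> : (c *: A) x = c *: A x by [].
have -> : (c^* *: adjoint A) y = c^* *: adjoint A y by [].
by rewrite innerZl innerZr conjCK adjointP.
Qed.

Lemma adjoint1 : adjoint (1 : boundedOp H) = 1.
Proof.
by apply: boundedOp_eqP => y; apply: eq_innerr => x; rewrite -adjointP.
Qed.

Definition skew_lie A B := A * B - B * adjoint A.

Lemma skew_lie1 B : skew_lie 1 B = 0.
Proof. by rewrite /skew_lie adjoint1 mul1r mulr1 subrr. Qed.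

Lemma skew_lieBr A B X : skew_lie A (B - X) = skew_lie A B - skew_lie A X.
Proof. by rewrite /skew_lie mulrBr mulrBl !opprD !opprK addrACA. Qed.

Lemma skew_lieZr c A B : skew_lie A (c *: B) = c *: skew_lie A B.
Proof. by rewrite /skew_lie -scaleOpAr -scaleOpAl scalerBr. Qed.

(** The conjugate-linearity of the adjoint turns the difference into a sum:
    this is how the product gives access to both A B and B A^*. *)
Lemma skew_lie_imaginary A B :
  skew_lie ('i *: A) B = 'i *: (A * B + B * adjoint A).
Proof.
by rewrite /skew_lie adjointZ conjCi -scaleOpAl -scaleOpAr scaleNr opprK
  scalerDr.
Qed.

Lemma scaler_imaginary_inj : injective (fun A => 'i *: A).
Proof. exact: scalerI (neq0Ci _). Qed.

Lemma addOp_self_inj : injective (fun A => A + A).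
Proof.
move=> A B /=; rewrite -[A + A]mulr2n -[B + B]mulr2n.
rewrite -(scaler_nat 2 A) -(scaler_nat 2 B).
have n2 : (2%:R : R[i]) != 0 by rewrite pnatr_eq0.
exact: (scalerI n2).
Qed.

Lemma skew_lie_imaginary1_eq0 X :
  skew_lie ('i *: (1 : boundedOp H)) X = 0 -> X = 0.
Proof.
rewrite skew_lie_imaginary adjoint1 mul1r mulr1 => iXX.
apply: addOp_self_inj; rewrite /= addr0.
by apply: scaler_imaginary_inj; rewrite /= iXX scaler0.
Qed.

Section SkewPreserving.
Context {M : set (boundedOp H)} {Phi : boundedOp H -> boundedOp H}.
Hypotheses (Malg : star_subalgebra M) (M1 : M 1).
Hypothesis Phi_surj : set_surj M M Phi.
Hypothesis Phi_skew : forall A B, M A -> M B ->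
  skew_lie (Phi A) (Phi B) = skew_lie A B.

Let MZ c A : M A -> M (c *: A).
Proof. by case: Malg => M0 ML _ _ MA; rewrite -[_ *: _]addr0; apply: ML. Qed.

Lemma skew_preserving_imaginary B : M B -> Phi ('i *: B) = 'i *: Phi B.
Proof.
move=> MB; apply/eqP; rewrite -subr_eq0; apply/eqP.
have [A MA PhiA] := Phi_surj _ (MZ 'i _ M1).
apply: skew_lie_imaginary1_eq0; rewrite -PhiA skew_lieBr skew_lieZr.
by rewrite !Phi_skew ?skew_lieZr ?subrr//; exact: MZ.
Qed.

Lemma skew_preserving_unit B : M B ->
  Phi 1 * Phi B = B /\ Phi B * adjoint (Phi 1) = B.
Proof.
move=> MB.
have /eqP := Phi_skew _ _ M1 MB; rewrite skew_lie1 subr_eq0 => /eqP eqT.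
have := Phi_skew _ _ (MZ 'i _ M1) MB.
rewrite skew_preserving_imaginary// !skew_lie_imaginary.
move=> /scaler_imaginary_inj.
by rewrite adjoint1 mul1r mulr1 -eqT => /addOp_self_inj TB.
Qed.

Lemma skew_preserving_unit_sqr : Phi 1 * Phi 1 = 1.
Proof. exact: (skew_preserving_unit _ M1).1. Qed.

Lemma skew_preserving_mul_unit B : M B ->
  Phi B = Phi 1 * B /\ Phi B = B * Phi 1.
Proof.
move=> MB; have [TB BT] := skew_preserving_unit _ MB.
have TT := skew_preserving_unit_sqr.
have adjT : adjoint (Phi 1) = Phi 1.
  have [_ TT'] := skew_preserving_unit _ M1.
  by rewrite -[LHS]mul1r -{1}TT -mulrA TT' mulr1.
split; first by rewrite -{2}TB mulrA TT mul1r.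
by rewrite -{2}BT adjT -mulrA TT mulr1.
Qed.

End SkewPreserving.

(** When H is the zero space every scalar multiple of 1 is 0, so c itself need
    not be a sign. *)
Lemma scalar_sqr1 c :
  (c *: (1 : boundedOp H)) * (c *: (1 : boundedOp H)) = 1 ->
  exists2 a : R[i], a = 1 \/ a = -1 &
    c *: (1 : boundedOp H) = a *: (1 : boundedOp H).
Proof.
rewrite -scaleOpAl mul1r scalerA => cc1.
have [H0|H0] := eqVneq (1 : boundedOp H) 0.
  by exists 1; [left | rewrite H0 !scaler0].
exists c => //.
have /eqP : (c * c - 1) *: (1 : boundedOp H) = 0.
  by rewrite scalerBl cc1 scale1r subrr.
rewrite scaler_eq0 (negPf H0) orbF -expr2 subr_eq0 sqrf_eq1.
by case/orP => /eqP; [left | right].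
Qed.

Lemma skew_lie_sign (a : R[i]) A B : a = 1 \/ a = -1 ->
  skew_lie (a *: A) (a *: B) = skew_lie A B.
Proof.
move=> a1; have [aR aa] : a^* = a /\ a * a = 1.
  by case: a1 => ->; rewrite ?rmorphN rmorph1 ?mulrNN mul1r.
rewrite skew_lieZr /skew_lie adjointZ aR -scaleOpAl -scaleOpAr -scalerBr.
by rewrite scalerA aa scale1r.
Qed.

End Operators.

Theorem theorem2p11 (R : realType) (H : hilbertType R)
    (M : set (boundedOp H)) (Phi : boundedOp H -> boundedOp H)
    (Mfactor : von_neumann_factor M)
    (PhiM : set_fun M M Phi) (Phi_surj : set_surj M M Phi) :
  (forall A B : boundedOp H, M A -> M B ->
     Phi A * Phi B - Phi B * adjoint (Phi A) = A * B - B * adjoint A)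
  <->
  (exists alpha : R[i], (alpha = 1 \/ alpha = -1) /\
     forall A : boundedOp H, M A -> Phi A = alpha *: A).
Proof.
have [[Malg _] Mcenter] := Mfactor.
have M1 : M 1.
  suff [] : Defs.center M 1 by [].
  by rewrite Mcenter; exists 1; rewrite ?scale1r.
split=> [Phi_skew|[a [a1 PhiE]] A B MA MB]; last first.
  by rewrite !PhiE//; exact: skew_lie_sign.
have PhiT := @skew_preserving_mul_unit _ _ _ _ Malg M1 Phi_surj Phi_skew.
have : Defs.center M (Phi 1).
  split; first exact: PhiM.
  by move=> A MA; have [<- <-] := PhiT _ MA.
rewrite Mcenter => -[c _ cT].
have [|a a1 aT] := @scalar_sqr1 _ H c.
  by rewrite cT; exact: skew_preserving_unit_sqr Malg M1 Phi_surj Phi_skew.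
exists a; split=> // A MA.
by rewrite (PhiT _ MA).1 -cT aT -scaleOpAl mul1r.
Qed.
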